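(* Let $d_{\mathrm{in}},d_{\mathrm{out}}\in\mathbb N$, $\Omega\subset\mathbb R^{d_{\mathrm{in}}}$, $\mu$ a measure on $\Omega$ with $C_p(\Omega,\mu)<\infty$, $\|\cdot\|$ a norm on $\mathbb R^{d_{\mathrm{out}}}$, $p,q\in[1,\infty]$, and $\mathcal F=L^p(\Omega\to(\mathbb R^{d_{\mathrm{out}}},\|\cdot\|),\mu)$. (i) There exists a constant $c>0$ (depending only on $\Omega,\mu,p,q,\|\cdot\|$) such that for every architecture $(L,\mathbf N)$ with $N_0=d_{\mathrm{in}}$, $N_L=d_{\mathrm{out}}$, of width $W=\max_{0\le\ell\le L}N_\ell$, and every $r\ge1$, $$\|R_\theta-R_{\theta'}\|_{p,\|\cdot\|}\le c\,W L^2 r^{L-1}\|\theta-\theta'\|_\infty\qquad\text{for all }\theta,\theta'\in\Theta^q_{L,\mathbf N}(r).$$ In particular, if $\Omega=[-D,D]^d$ ($D>0$, $d=d_{\mathrm{in}}$) and $\mu$ is the Lebesgue measure, this holds with $c=Dd^{1/q}+1$ when $p=\infty$ and $\|\cdot\|=\|\cdot\|_q$, and with $c=(D+1)(2D)^{d/p}$ when $\|\cdot\|=\|\cdot\|_\infty$ and $q=\infty$. (ii) Conversely, assume $\Omega\subseteq\mathbb R_+^{d_{\mathrm{in}}}$ (where $\mathbb R_+=[0,\infty)$), $\|\cdot\|=\|\cdot\|_q$, and $\mu(\{x\in\Omega: x_1\neq0\})>0$, and either $p=\infty$, or $1\le p<\infty$ and we restrict to architectures with $N_0=\min_{0\le\ell\le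 L}N_\ell$. Then there is a constant $c'>0$ independent of the architecture and of $r$ such that for every such architecture $(L,\mathbf N)$ (with $N_0=d_{\mathrm{in}}$, $N_L=d_{\mathrm{out}}$), every $r\ge1$ and every $\varepsilon>0$, there exist $\theta\neq\theta'$ in $\Theta^q_{L,\mathbf N}(r)$ with $$\|R_\theta-R_{\theta'}\|_{p,\|\cdot\|}\ge(1-\varepsilon)\,c'\,L\,r^{L-1}\|\theta-\theta'\|_\infty.$$
   Context: ReLU $\rho(x)=\max(0,x)$ coordinatewise. Architecture $(L,\mathbf N)$, $\mathbf N=(N_0,\dots,N_L)$, width $W=\max_\ell N_\ell$; parameters $\theta=(W_1,\dots,W_L,b_1,\dots,b_L)$, $W_\ell\in\mathbb R^{N_\ell\times N_{\ell-1}}$, $b_\ell\in\mathbb R^{N_\ell}$, forming $\Theta_{L,\mathbf N}$; $\|\theta\|_\infty$ is the largest absolute value of a coordinate of $\theta$. Realization: $R_\theta(x)=W_Ly_{L-1}(x)+b_L$, $y_0(x)=x$, $y_\ell(x)=\rho(W_\ell y_{\ell-1}(x)+b_\ell)$ for $1\le\ell\le L-1$. For a matrix $M$, $\|M\|_{q\to q}=\sup_{x\ne0}\|Mx\|_q/\|x\|_q$ is the operator norm. $\Theta^q_{L,\mathbf N}(r)=\{\theta\in\Theta_{L,\mathbf N}:\|W_\ell\|_{q\to q}\le r,\ \|b_\ell\|_q\le r,\ \ell=1,\dots,L\}$. $\|f\|_{p,\|\cdot\|}=(\int_\Omega\|f(x)\|^pd\mu)^{1/p}$ for $p<\infty$,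 $\operatorname{ess\,sup}_\Omega\|f(x)\|$ for $p=\infty$. $C_p(\Omega,\mu)=(\int_\Omega(\|x\|_\infty+1)^pd\mu)^{1/p}$ for $p<\infty$ and $\operatorname{ess\,sup}_\Omega\|x\|_\infty$ for $p=\infty$. *)

(* Defs.v *)
From HB Require Import structures.
From mathcomp Require Import all_boot all_order all_algebra.
From mathcomp Require Import all_classical all_reals all_analysis.
From mathcomp Require Import ess_sup_inf hoelder.
Set Implicit Arguments. Unset Strict Implicit. Unset Printing Implicit Defensive.
Import Order.TTheory GRing.Theory Num.Theory.
Import numFieldNormedType.Exports.
Local Open Scope classical_set_scope.
Local Open Scope ring_scope.

Section Defs.
Variable R : realType.

Definition is_norm (n : nat) (nm : 'cV[R]_n -> R) : Prop :=
  [/\ forall x, nm x = 0 -> x = 0,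
      forall (a : R) x, nm (a *: x) = `|a| * nm x
    & forall x y, nm (x + y) <= nm x + nm y].

(* the l^q norm, q in [1, +oo] (value at -oo is irrelevant) *)
Definition vnorm (q : \bar R) (n : nat) (v : 'cV[R]_n) : R :=
  match q with
  | r%:E => (\sum_(i < n) `|v i 0| `^ r) `^ r^-1
  | +oo%E => \big[Num.max/0]_(i < n) `|v i 0|
  | -oo%E => 0
  end.

Definition opnorm (q : \bar R) (m n : nat) (M : 'M[R]_(m, n)) : R :=
  sup [set vnorm q (M *m x) / vnorm q x | x in [set x : 'cV[R]_n | x != 0]].

(* index sets of the coordinates of theta for the architecture (L, N);
   layer l : 'I_L is layer number l+1, W_{l+1} : 'M_(N (l+1), N l). *)
Definition widx (L : nat) (N : nat -> nat) :=
  {l : 'I_L & ('I_(N l.+1) * 'I_(N l))%type}.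
Definition bidx (L : nat) (N : nat -> nat) := {l : 'I_L & 'I_(N l.+1)}.

Definition params (L : nat) (N : nat -> nat) :=
  ({ffun widx L N -> R} * {ffun bidx L N -> R})%type.

Definition Wmat L N (th : params L N) (l : 'I_L) : 'M[R]_(N l.+1, N l) :=
  \matrix_(i, j) th.1 (existT _ l (i, j)).
Definition bvec L N (th : params L N) (l : 'I_L) : 'cV[R]_(N l.+1) :=
  \col_i th.2 (existT _ l i).

Definition relu (n : nat) (v : 'cV[R]_n) : 'cV[R]_n := map_mx (fun a => Num.max a 0) v.

Definition step L N (th : params L N) (k : nat) (v : 'cV[R]_(N k)) : 'cV[R]_(N k.+1) :=
  match (k < L)%N as b return (k < L)%N = b -> 'cV[R]_(N k.+1) with
  | true => fun h =>
      let z := Wmat th (Ordinal h) *m v + bvec th (Ordinal h) in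
      if k.+1 == L then z else relu z
  | false => fun _ => 0
  end erefl.

Fixpoint fwd L N (th : params L N) (k : nat) : 'cV[R]_(N 0) -> 'cV[R]_(N k) :=
  match k as k0 return 'cV[R]_(N 0) -> 'cV[R]_(N k0) with
  | 0 => fun x => x
  | k'.+1 => fun x => step th (fwd th k' x)
  end.

Definition realization L N (th : params L N) : 'cV[R]_(N 0) -> 'cV[R]_(N L) :=
  fwd th L.

(* points of Omega are din-tuples; as column vectors *)
Definition tup2col (n : nat) (x : n.-tuple R) : 'cV[R]_n := \col_i tnth x i.

Definition netfun din dout L N (h0 : N 0 = din) (hL : N L = dout)
  (th : params L N) (x : din.-tuple R) : 'cV[R]_dout :=
  castmx (hL, erefl) (realization th (castmx (esym h0, erefl) (tup2col x))).

Definition in_Theta (q : \bar R) L N (r : R) (th : params L N) : Prop :=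
  forall l : 'I_L, opnorm q (Wmat th l) <= r /\ vnorm q (bvec th l) <= r.

Definition pdist L N (th th' : params L N) : R :=
  Num.max (\big[Num.max/0]_(i : widx L N) `|th.1 i - th'.1 i|)
          (\big[Num.max/0]_(i : bidx L N) `|th.2 i - th'.2 i|).

Definition width (L : nat) (N : nat -> nat) : nat := \max_(l < L.+1) N l.

Definition supn (n : nat) (x : n.-tuple R) : R := \big[Num.max/0]_(i < n) `|tnth x i|.

(* C_p(Omega, mu) (mu is concentrated on Omega) *)
Definition Cp (n : nat) (mu : {measure set (n.-tuple R) -> \bar R}) (p : \bar R)
  : \bar R :=
  match p with
  | r%:E => ((\int[mu]_x ((supn x + 1)%:E `^ r)) `^ r^-1)%E
  | +oo%E => ess_sup mu (fun x => (supn x)%:E)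
  | -oo%E => 0%E
  end.

Definition netdist (din dout : nat) (mu : {measure set (din.-tuple R) -> \bar R})
  (p : \bar R) (nm : 'cV[R]_dout -> R) (f g : din.-tuple R -> 'cV[R]_dout) : \bar R :=
  Lnorm mu p (fun x => (nm (f x - g x))%:E).

Definition einv (p : \bar R) : R := match p with r%:E => r^-1 | _ => 0 end.

Definition cube (n : nat) (D : R) : set (n.-tuple R) :=
  [set x | forall i : 'I_n, - D <= tnth x i <= D].

(* lam is the Lebesgue measure on R^n (Borel sets): it gives every closed box
   its volume (this determines the measure uniquely) *)
Definition is_lebesgue (n : nat) (lam : {measure set (n.-tuple R) -> \bar R}) : Prop :=
  forall a b : n.-tuple R, (forall i, tnth a i <= tnth b i) ->
    lam [set x | forall i : 'I_n, tnth a i <= tnth x i <= tnth b i]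
    = (\prod_(i < n) (tnth b i - tnth a i))%:E.

End Defs.

(* Main.v *)
Require Import Defs.
From HB Require Import structures.
From mathcomp Require Import all_boot all_order all_algebra.
From mathcomp Require Import all_classical all_reals all_analysis.
From mathcomp Require Import ess_sup_inf hoelder.
From mathcomp Require Import measurable_realfun ring lra.
Import Order.TTheory GRing.Theory Num.Theory.
Import numFieldNormedType.Exports.
Local Open Scope classical_set_scope.
Local Open Scope ring_scope.

(** Upper bounds: if [|theta - theta'|_oo <= delta], then [|W - W'|_(q->q) <= width * delta]
    for every layer, while [|y_k| <= r^k (|x|_q + k)]. Since ReLU is 1-Lipschitz, the error
    satisfies [e_(k+1) <= r e_k + width * delta * (r^k (|x|_q + k) + 1)], whence
    [e_L <= width * L^2 * r^(L-1) * delta * (|x|_q + 1)] pointwise; taking L^p norms gives (i).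

    Lower bound: on nonnegative inputs, the network whose weight matrices are all [a E_11],
    without biases, computes [a^L x_1 e_1]. Comparing [a = r] with [a = r (1 - s)] for a small
    [s > 0] gives the factor [r^L (1 - (1 - s)^L) >= (1 - eps) L r^(L-1) (r s)], and [c'] is
    the L^p norm of [max(x_1, 0)]. *)

(** * Vector and operator norms *)

Section VectorNorm.
Set Implicit Arguments. Unset Strict Implicit.
Variables (R : realType) (q : \bar R).
Hypothesis q1 : (1 <= q)%E.

Lemma sum_powR_ge0 n (v : 'cV[R]_n) (r : R) : 0 <= \sum_(i < n) `|v i 0| `^ r.
Proof. by apply: sumr_ge0 => i _; exact: powR_ge0. Qed.

Lemma vnorm_ge0 n (v : 'cV[R]_n) : 0 <= vnorm q v.
Proof.
case: q => [r| |] //=; first exact: powR_ge0.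
exact: bigmax_ge_id.
Qed.

(** The injection [f] lets one comparison serve entrywise bounds, the extraction of a single
    coordinate and cyclic shifts of the indices. *)
Lemma ler_vnorm n m (u : 'cV[R]_n) (v : 'cV[R]_m) (f : 'I_n -> 'I_m) :
  injective f -> (forall i, `|u i 0| <= `|v (f i) 0|) -> vnorm q u <= vnorm q v.
Proof.
move=> fI uv; case: q q1 => [r| |] //=.
- rewrite lee_fin => r1; have r0 : 0 <= r by exact: le_trans r1.
  rewrite ge0_ler_powR ?invr_ge0 ?nnegrE ?sum_powR_ge0 //.
  apply: (@le_trans _ _ (\sum_(i < n) `|v (f i) 0| `^ r)).
    by apply: ler_sum => i _; rewrite ge0_ler_powR ?nnegrE.
  rewrite -(big_imset (fun j => `|v j 0| `^ r) (h := f) (A := predT)) /=; last first.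
    by move=> x y _ _ /fI.
  rewrite [leRHS](bigID (mem (f @: predT)%SET)) /= lerDl.
  by apply: sumr_ge0 => i _; exact: powR_ge0.
- move=> _; apply: bigmax_le => [|i _]; first exact: bigmax_ge_id.
  exact: le_trans (uv i) (le_bigmax _ (fun i => `|v i 0|) (f i)).
Qed.

Lemma vnormZ n (a : R) (v : 'cV[R]_n) : vnorm q (a *: v) = `|a| * vnorm q v.
Proof.
case: q q1 => [r| |] //=; last first.
  move=> _; rewrite (big_morph _ (fun x y => maxr_pMr x y (normr_ge0 a)) (mulr0 _)).
  by apply: eq_bigr => i _; rewrite mxE normrM.
rewrite lee_fin => r1; have r0 : r != 0 by rewrite gt_eqF // (lt_le_trans _ r1).
under eq_bigr do rewrite mxE normrM powRM //.
rewrite -mulr_sumr powRM ?powR_ge0 ?sum_powR_ge0 //.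
by rewrite -powRrM mulfV // powRr1.
Qed.

(** Positivity of [n] excludes the empty vector with q infinite, where the norm is 0 but the power
    0^0 is 1. *)
Lemma vnorm_const n (a : R) : (0 < n)%N ->
  vnorm q (const_mx a : 'cV[R]_n) = n%:R `^ einv q * `|a|.
Proof.
move=> n0; case: q q1 => [r| |] //=.
- rewrite lee_fin => r1; have r0 : r != 0 by rewrite gt_eqF // (lt_le_trans _ r1).
  under eq_bigr do rewrite mxE.
  rewrite sumr_const card_ord -[X in X `^ _]mulr_natl powRM ?powR_ge0 //.
  by rewrite -powRrM mulfV // powRr1.
- move=> _; rewrite powRr0 mul1r.
  under eq_bigr do rewrite mxE.
  apply/le_anti/andP; split; first by apply: bigmax_le.
  exact: (le_bigmax _ (fun=> `|a|) (Ordinal n0)).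
Qed.

Lemma norm_le_vnorm n (v : 'cV[R]_n) i : `|v i 0| <= vnorm q v.
Proof.
(* A single entry is a vector of length 1, whose q-norm is its absolute value. *)
have := @vnorm_const 1 (v i 0) isT; rewrite powR1 mul1r => <-.
apply: (@ler_vnorm _ _ _ _ (fun=> i)) => [x y _|j]; first by rewrite !ord1.
by rewrite mxE.
Qed.

Lemma vnorm0 n : vnorm q (0 : 'cV[R]_n) = 0.
Proof. by rewrite -(scale0r (0 : 'cV[R]_n)) vnormZ normr0 mul0r. Qed.

Lemma vnorm_eq0 n (v : 'cV[R]_n) : vnorm q v = 0 -> v = 0.
Proof.
move=> v0; apply/colP => i; rewrite mxE; apply/eqP; rewrite -normr_le0.
by rewrite -v0 norm_le_vnorm.
Qed.

Lemma vnorm_le n (u v : 'cV[R]_n) :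
  (forall i, `|u i 0| <= `|v i 0|) -> vnorm q u <= vnorm q v.
Proof. exact: (@ler_vnorm _ _ _ _ id). Qed.

(** Minkowski's inequality from convexity of the r-th power: with a and b the norms of u and v,
    (|u_i| + |v_i|)/(a + b) is a convex combination of |u_i|/a and |v_i|/b, with weights a/(a + b)
    and b/(a + b). Summing the r-th powers gives at most 1. Zero norms are settled first, since a
    and b become denominators. *)
Lemma vnormD n (u v : 'cV[R]_n) : vnorm q (u + v) <= vnorm q u + vnorm q v.
Proof.
have [u0|u0] := eqVneq (vnorm q u) 0; first by rewrite (vnorm_eq0 u0) vnorm0 !add0r.
have [v0|v0] := eqVneq (vnorm q v) 0; first by rewrite (vnorm_eq0 v0) vnorm0 !addr0.
have ua : 0 < vnorm q u by rewrite lt_neqAle eq_sym u0 vnorm_ge0.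
have vb : 0 < vnorm q v by rewrite lt_neqAle eq_sym v0 vnorm_ge0.
case: q q1 u0 v0 ua vb => [r| |] //=; last first.
  move=> _ _ _ _ _; apply: bigmax_le => [|i _].
    by rewrite addr_ge0 //; exact: bigmax_ge_id.
  rewrite mxE; apply: le_trans (ler_normD _ _) _.
  apply: lerD; first exact: (le_bigmax _ (fun i => `|u i 0|) i).
  exact: (le_bigmax _ (fun i => `|v i 0|) i).
rewrite lee_fin => r1 _ _ + +.
have r0 : r != 0 by rewrite gt_eqF // (lt_le_trans _ r1).
have r00 : 0 <= r by exact: le_trans r1.
have sE (w : 'cV[R]_n) :
    ((\sum_(i < n) `|w i 0| `^ r) `^ r^-1) `^ r = \sum_(i < n) `|w i 0| `^ r.
  by rewrite -powRrM mulVf // powRr1 ?sum_powR_ge0.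
move: (sE u) (sE v); move: ((\sum_(i < n) `|u i 0| `^ r) `^ r^-1) => a.
move: ((\sum_(i < n) `|v i 0| `^ r) `^ r^-1) => b aE bE a0 b0.
have ab0 : 0 < a + b by rewrite addr_gt0.
rewrite (_ : a + b = ((a + b) `^ r) `^ r^-1); last by rewrite -powRrM mulfV // powRr1 // ltW.
rewrite ge0_ler_powR ?invr_ge0 ?nnegrE ?powR_ge0 ?sum_powR_ge0 //.
pose t := a / (a + b).
have t0 : 0 <= t by rewrite divr_ge0 ?ltW.
have t1 : t <= 1 by rewrite ler_pdivrMr // mul1r lerDl ltW.
have cvx i : `|(u + v) i 0| `^ r <=
    (a + b) `^ r * (t * (`|u i 0| `^ r / a `^ r) + (1 - t) * (`|v i 0| `^ r / b `^ r)).
  have H : (t * (`|u i 0| / a) + (1 - t) * (`|v i 0| / b)) `^ r <=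
      t * (`|u i 0| / a) `^ r + (1 - t) * (`|v i 0| / b) `^ r.
    apply: (@convex_powR _ _ r1 (Itv01 t0 t1)) => /=.
      by rewrite inE /= in_itv /= andbT divr_ge0 ?(ltW a0).
    by rewrite inE /= in_itv /= andbT divr_ge0 ?(ltW b0).
  rewrite [(`|u i 0| / a) `^ r]powRM ?invr_ge0 ?(ltW a0) // in H.
  rewrite [(`|v i 0| / b) `^ r]powRM ?invr_ge0 ?(ltW b0) // in H.
  have pV (c : R) : 0 < c -> c^-1 `^ r = (c `^ r)^-1.
    by move=> c0; rewrite -powR_inv1 ?(ltW c0) // powRAC powR_inv1 ?powR_ge0.
  rewrite !pV // in H.
  apply: le_trans (ler_wpM2l (powR_ge0 _ _) H).
  have w0 : 0 <= t * (`|u i 0| / a) + (1 - t) * (`|v i 0| / b).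
    by rewrite addr_ge0 // mulr_ge0 ?subr_ge0 // divr_ge0 // ltW.
  rewrite -powRM ?(ltW ab0) //.
  rewrite ge0_ler_powR ?nnegrE ?mulr_ge0 ?(ltW ab0) //.
  rewrite mxE (_ : (a + b) * _ = `|u i 0| + `|v i 0|) ?ler_normD // /t.
  by field; rewrite !gt_eqF.
apply: le_trans (ler_sum _ (fun i _ => cvx i)) _.
rewrite -mulr_sumr big_split /= -!mulr_sumr -!mulr_suml -aE -bE.
rewrite !mulfV ?gt_eqF ?powR_gt0 //; lra.
Qed.

Lemma vnorm_sum n (I : finType) (F : I -> 'cV[R]_n) :
  vnorm q (\sum_i F i) <= \sum_i vnorm q (F i).
Proof.
elim/big_rec2: _ => [|i y1 y2 _ H]; first by rewrite vnorm0.
by apply: le_trans (vnormD _ _) _; rewrite lerD2l.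
Qed.

Lemma einv_ge0 : 0 <= einv q.
Proof. by case: q q1 => [r| |] //=; rewrite lee_fin invr_ge0; exact: le_trans. Qed.

Lemma einv_le1 : einv q <= 1.
Proof.
case: q q1 => [r| |] //=; rewrite lee_fin => r1.
by rewrite invf_le1 // (lt_le_trans _ r1).
Qed.

(* The sum of the cyclic shifts of |x| is the constant vector |x|_1; its q-norm
   is at most n |x|_q, which is Hoelder's inequality between |.|_1 and |.|_q. *)
Lemma sum_norm_le_vnorm n (x : 'cV[R]_n.+1) :
  n.+1%:R `^ einv q * \sum_i `|x i 0| <= n.+1%:R * vnorm q x.
Proof.
have S0 : 0 <= \sum_i `|x i 0| by exact: sumr_ge0.
rewrite -{1}(ger0_norm S0) -vnorm_const //.
have -> : const_mx (\sum_i `|x i 0|) = \sum_(k < n.+1) \col_i `|x (i + k) 0|.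
  apply/colP => i; rewrite mxE summxE (reindex_inj (addrI i)) /=.
  by apply: eq_bigr => k _; rewrite mxE.
apply: le_trans (vnorm_sum _) _.
have -> : n.+1%:R * vnorm q x = \sum_(k < n.+1) vnorm q x.
  by rewrite sumr_const card_ord mulr_natl.
apply: ler_sum => k _.
apply: (@ler_vnorm _ _ _ _ (fun i => i + k)) => [|i]; first exact: addIr.
by rewrite mxE normr_id.
Qed.

(** Each entry of Mx is at most delta |x|_1, so |Mx|_q <= m^(1/q) delta |x|_1, and Hoelder gives
    |x|_1 <= n^(1-1/q) |x|_q. The exponents add up to 1, so W bounds the product of the two
    powers. *)
Lemma vnorm_mulmx_le m n (M : 'M[R]_(m, n)) (x : 'cV[R]_n) (W : nat) (delta : R) :
  (m <= W)%N -> (n <= W)%N -> 0 <= delta -> (forall i j, `|M i j| <= delta) ->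
  vnorm q (M *m x) <= W%:R * delta * vnorm q x.
Proof.
case: n M x => [|n] M x mW nW d0 Md.
  rewrite (_ : M *m x = 0) ?vnorm0 ?mulr_ge0 ?vnorm_ge0 //.
  by apply/colP => i; rewrite !mxE big_ord0.
case: m M mW Md => [|m] M mW Md.
  by rewrite (flatmx0 (M *m x)) vnorm0 !mulr_ge0 ?vnorm_ge0.
set S := \sum_i `|x i 0|; have S0 : 0 <= S by exact: sumr_ge0.
apply: (@le_trans _ _ (vnorm q (const_mx (delta * S) : 'cV[R]_m.+1))).
  apply: vnorm_le => i; rewrite !mxE (ger0_norm (mulr_ge0 _ _)) //.
  apply: le_trans (ler_norm_sum _ _ _) _.
  by rewrite mulr_sumr; apply: ler_sum => j _; rewrite normrM ler_wpM2r.
rewrite vnorm_const // ger0_norm ?mulr_ge0 // mulrCA [leRHS]mulrAC [leRHS]mulrC.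
apply: ler_wpM2l => //.
apply: (@le_trans _ _ (W%:R `^ einv q * S)).
  by rewrite ler_wpM2r // ge0_ler_powR ?nnegrE ?einv_ge0 // ler_nat.
have n0 : (0 : R) < n.+1%:R by rewrite ltr0n.
(* Since c >= 1 and 1/q <= 1, c^(1/q) <= c; this reduces the claim for W to Hoelder's inequality in
   the number of columns. *)
pose c : R := W%:R / n.+1%:R.
have c1 : 1 <= c by rewrite ler_pdivlMr // mul1r ler_nat.
have c0 : 0 <= c by exact: le_trans c1.
have -> : W%:R = c * n.+1%:R by rewrite mulrVK // unitfE gt_eqF.
clearbody c; rewrite powRM ?(ltW n0) // -!mulrA.
apply: ler_pM; rewrite ?mulr_ge0 ?powR_ge0 ?sum_norm_le_vnorm //.
by rewrite -[leRHS]powRr1 // ler_powR // einv_le1.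
Qed.

Lemma vnorm_le_unif n (v : 'cV[R]_n) (W : nat) (delta : R) :
  (n <= W)%N -> 0 <= delta -> (forall i, `|v i 0| <= delta) ->
  vnorm q v <= W%:R * delta.
Proof.
case: W => [|W] nW d0 vd.
  by move: nW v vd; rewrite leqn0 => /eqP -> v _; rewrite (flatmx0 v) vnorm0 mul0r.
(* The vector is read as a one-column matrix applied to the vector with sole entry 1. *)
have := @vnorm_mulmx_le _ 1 v (const_mx 1) W.+1 delta nW isT d0.
rewrite vnorm_const // powR1 normr1 !mulr1 (_ : v *m _ = v); last first.
  by apply/colP => i; rewrite !mxE big_ord1 mxE mulr1.
by apply => i j; rewrite ord1.
Qed.

(** A real supremum dominates its members only when the set is bounded above; the sum of all
    absolute entries bounds each entry and so yields a crude upper bound. *)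
Lemma vnorm_mulmx_opnorm m n (M : 'M[R]_(m, n)) (x : 'cV[R]_n) :
  vnorm q (M *m x) <= opnorm q M * vnorm q x.
Proof.
have [->|x0] := eqVneq x 0; first by rewrite mulmx0 !vnorm0 mulr0.
have v0 y : y != 0 :> 'cV[R]_n -> 0 < vnorm q y.
  move=> y0; rewrite lt_neqAle vnorm_ge0 andbT eq_sym.
  by apply: contra y0 => /eqP /vnorm_eq0 ->.
rewrite -ler_pdivrMr ?v0 //; apply: ub_le_sup; last by exists x.
pose d := \sum_i \sum_j `|M i j|.
have d0 : 0 <= d by apply: sumr_ge0 => i _; exact: sumr_ge0.
exists ((maxn m n)%:R * d) => _ [y /= y0 <-].
rewrite ler_pdivrMr ?v0 //; apply: vnorm_mulmx_le; rewrite ?leq_maxl ?leq_maxr // => i j.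
rewrite /d (bigD1 i) //= (bigD1 j) //= -addrA lerDl addr_ge0 //.
  exact: sumr_ge0.
by apply: sumr_ge0 => *; exact: sumr_ge0.
Qed.

(** Positive [n] provides a nonzero vector, so the supremum is taken over a nonempty set. *)
Lemma opnorm_le m n (M : 'M[R]_(m, n)) (r : R) : (0 < n)%N ->
  (forall x, vnorm q (M *m x) <= r * vnorm q x) -> opnorm q M <= r.
Proof.
case: n M => // n M _ Mr; apply: ge_sup.
  exists (vnorm q (M *m const_mx 1) / vnorm q (const_mx 1 : 'cV[R]_n.+1)).
  exists (const_mx 1) => //=; apply/eqP => /colP/(_ 0); rewrite !mxE => /eqP.
  by rewrite oner_eq0.
move=> _ [x /= x0 <-]; rewrite ler_pdivrMr //.
rewrite lt_neqAle vnorm_ge0 andbT eq_sym.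
by apply: contra x0 => /eqP /vnorm_eq0 ->.
Qed.

End VectorNorm.

(** * Propagation through the layers *)

Section Network.
Set Implicit Arguments. Unset Strict Implicit.
Variables (R : realType) (L : nat) (N : nat -> nat).
Implicit Types th : params R L N.

Definition preact th k (h : (k < L)%N) (v : 'cV[R]_(N k)) : 'cV[R]_(N k.+1) :=
  Wmat th (Ordinal h) *m v + bvec th (Ordinal h).

(** Removes the dependent match: generalising its equality proof allows a case split, after which
    the two proofs of [k < L] agree by irrelevance. *)
Lemma stepE th k (h : (k < L)%N) (v : 'cV[R]_(N k)) :
  step th v = if k.+1 == L then preact th h v else relu (preact th h v).
Proof.
rewrite /step /preact; move: (erefl (k < L)%N).
case: {2 3}(k < L)%N => h'; last by rewrite h in h'.
by rewrite (bool_irrelevance h h').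
Qed.

Lemma fwdS th k x : fwd th k.+1 x = step th (fwd th k x).
Proof. by []. Qed.

Lemma norm_Wmat_le_pdist th th' (l : 'I_L) i j :
  `|(Wmat th l - Wmat th' l) i j| <= pdist th th'.
Proof.
rewrite !mxE /pdist le_max; apply/orP; left.
exact: (le_bigmax _ (fun i => `|th.1 i - th'.1 i|) (existT _ l (i, j))).
Qed.

Lemma norm_bvec_le_pdist th th' (l : 'I_L) i :
  `|(bvec th l - bvec th' l) i 0| <= pdist th th'.
Proof.
rewrite !mxE /pdist le_max; apply/orP; right.
exact: (le_bigmax _ (fun i => `|th.2 i - th'.2 i|) (existT _ l i)).
Qed.

Lemma pdist_ge0 th th' : 0 <= pdist th th'.
Proof. by rewrite /pdist le_max bigmax_ge_id. Qed.

Lemma leq_width k : (k <= L)%N -> (N k <= width L N)%N.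
Proof.
rewrite -ltnS => h; exact: (bigop.leq_bigmax (F := fun i : 'I_L.+1 => N i) (Ordinal h)).
Qed.

Lemma ler_norm_maxB (a b c : R) : `|Num.max a c - Num.max b c| <= `|a - b|.
Proof.
rewrite !maxEle; case: (leP a c) => ac; case: (leP b c) => bc;
  rewrite ?subrr ?normr0 //.
- rewrite distrC [leRHS]distrC gtr0_norm ?subr_gt0 //.
  by apply: le_trans _ (ler_norm _); lra.
- rewrite gtr0_norm ?subr_gt0 //.
  by apply: le_trans _ (ler_norm _); lra.
Qed.

Variable q : \bar R.
Hypothesis q1 : (1 <= q)%E.

Lemma vnorm_reluB n (u v : 'cV[R]_n) :
  vnorm q (relu u - relu v) <= vnorm q (u - v).
Proof.
by apply: vnorm_le => // i; rewrite !mxE ler_norm_maxB.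
Qed.

Lemma vnorm_relu n (u : 'cV[R]_n) : vnorm q (relu u) <= vnorm q u.
Proof.
have r0 : relu (0 : 'cV[R]_n) = 0 by apply/colP => i; rewrite !mxE maxxx.
by have := vnorm_reluB u 0; rewrite r0 !subr0.
Qed.

Variable r : R.
Hypothesis r1 : 1 <= r.

Let r0 : 0 <= r. Proof. exact: le_trans r1. Qed.

(** Each layer multiplies the norm by at most r and adds at most r; as r >= 1, the added r is at
    most r^(k+1) and is absorbed by raising k to k + 1. *)
Lemma vnorm_fwd th k x : in_Theta q r th -> (k <= L)%N ->
  vnorm q (fwd th k x) <= r ^+ k * (vnorm q x + k%:R).
Proof.
move=> thr; elim: k => [|k IH] kL; first by rewrite expr0 mul1r addr0.
rewrite fwdS (stepE _ kL).
apply: (@le_trans _ _ (vnorm q (preact th kL (fwd th k x)))).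
  by case: ifP => // _; exact: vnorm_relu.
apply: le_trans (vnormD q1 _ _) _.
have [Wr br] := thr (Ordinal kL).
apply: (@le_trans _ _ (r * (r ^+ k * (vnorm q x + k%:R)) + r)).
  apply: lerD => //; apply: le_trans (vnorm_mulmx_opnorm q1 _ _) _.
  apply: (@le_trans _ _ (r * vnorm q (fwd th k x))).
    by apply: ler_wpM2r => //; exact: vnorm_ge0.
  by apply: ler_wpM2l => //; apply: IH; exact: ltnW.
have : r <= r ^+ k.+1 by rewrite exprS ler_peMr // exprn_ege1.
rewrite mulrA -exprS -natr1; nra.
Qed.

(** Induction on the error recursion. At k = 0 the factor k^2 makes the bound zero, so the truncated
    predecessor in the exponent is harmless. *)
Lemma vnorm_fwdB th th' k x : in_Theta q r th -> in_Theta q r th' -> (k <= L)%N ->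
  vnorm q (fwd th k x - fwd th' k x) <=
    (width L N)%:R * pdist th th' * r ^+ k.-1 * (k%:R ^+ 2 * (vnorm q x + 1)).
Proof.
move=> thr thr'; elim: k => [|k IH] kL.
  by rewrite subrr vnorm0 // expr0n /= !(mul0r, mulr0).
rewrite !fwdS !(stepE _ kL).
set y := fwd th k x; set y' := fwd th' k x.
apply: (@le_trans _ _ (vnorm q (preact th kL y - preact th' kL y'))).
  by case: ifP => // _; exact: vnorm_reluB.
have [Wr br] := thr (Ordinal kL).
(* The difference splits into the propagated error, the weight perturbation acting on y', and the
   bias perturbation. *)
have -> : preact th kL y - preact th' kL y' = Wmat th (Ordinal kL) *m (y - y') +
    ((Wmat th (Ordinal kL) - Wmat th' (Ordinal kL)) *m y' +
     (bvec th (Ordinal kL) - bvec th' (Ordinal kL))).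
  rewrite /preact mulmxBr mulmxBl opprD !addrA; congr (_ + _).
  by rewrite subrK addrAC.
set W := (width L N)%:R; set d := pdist th th'; set X := vnorm q x.
have d0 : 0 <= d by exact: pdist_ge0.
have X0 : 0 <= X by exact: vnorm_ge0.
have W0 : 0 <= W :> R by exact: ler0n.
have H1 : vnorm q (Wmat th (Ordinal kL) *m (y - y')) <=
    W * d * r ^+ k * (k%:R ^+ 2 * (X + 1)).
  apply: le_trans (vnorm_mulmx_opnorm q1 _ _) _.
  apply: (@le_trans _ _ (r * vnorm q (y - y'))).
    by apply: ler_wpM2r => //; exact: vnorm_ge0.
  apply: le_trans (ler_wpM2l r0 (IH (ltnW kL))) _.
  case: (k) => [|m]; first by rewrite expr0n /= !(mul0r, mulr0).
  by rewrite [r ^+ m.+1]exprS -/W -/d -/X /= le_eqVlt; apply/orP; left; apply/eqP; ring.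
have H2 : vnorm q ((Wmat th (Ordinal kL) - Wmat th' (Ordinal kL)) *m y') <=
    W * d * (r ^+ k * (X + k%:R)).
  have Hm := (vnorm_mulmx_le q1 y' (leq_width kL) (leq_width (ltnW kL)) d0
    (@norm_Wmat_le_pdist th th' (Ordinal kL))).
  apply: le_trans Hm _.
  by apply: ler_wpM2l; rewrite ?mulr_ge0 // vnorm_fwd // ltnW.
have H3 : vnorm q (bvec th (Ordinal kL) - bvec th' (Ordinal kL)) <= W * d.
  by apply: vnorm_le_unif => //; [exact: leq_width | exact: norm_bvec_le_pdist].
apply: le_trans (vnormD q1 _ _) _; apply: le_trans (lerD H1 (vnormD q1 _ _)) _.
apply: le_trans (lerD (lexx _) (lerD H2 H3)) _ => /=.
have rk : 1 <= r ^+ k by exact: exprn_ege1.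
have Wd : 0 <= W * d by exact: mulr_ge0.
rewrite [leLHS](_ : _ = W * d *
  (r ^+ k * (k%:R ^+ 2 * (X + 1)) + (r ^+ k * (X + k%:R) + 1))); last ring.
rewrite [leRHS](_ : _ = W * d * (r ^+ k * (k.+1%:R ^+ 2 * (X + 1)))); last ring.
apply: ler_wpM2l => //.
have k0 : 0 <= k%:R :> R by exact: ler0n.
rewrite -natr1.
(* First the bias term 1 is absorbed using r^k >= 1; then (k + 1)^2 (X + 1) exceeds k^2 (X + 1) + X
   + k + 1 by 2kX + k. *)
apply: (@le_trans _ _ (r ^+ k * (k%:R ^+ 2 * (X + 1) + X + k%:R + 1))); first by nra.
apply: ler_wpM2l; first lra.
nra.
Qed.

End Network.

Lemma vnorm_netfunB (R : realType) (q : \bar R) (r : R) din dout L N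
    (h0 : N 0%N = din) (hL : N L = dout) (th th' : params R L N) x :
  (1 <= q)%E -> 1 <= r -> in_Theta q r th -> in_Theta q r th' ->
  vnorm q (netfun h0 hL th x - netfun h0 hL th' x) <=
    (width L N)%:R * L%:R ^+ 2 * r ^+ (L - 1) * pdist th th' *
    (vnorm q (tup2col x) + 1).
Proof.
move=> q1 r1 thr thr'; subst din dout.
rewrite /netfun /= !castmx_id.
apply: le_trans (vnorm_fwdB q1 r1 _ thr thr' (leqnn L)) _.
rewrite subn1 le_eqVlt; apply/orP; left; apply/eqP; ring.
Qed.

(** * Lebesgue norms *)

Section LebesgueNorm.
Set Implicit Arguments. Unset Strict Implicit.
Context d (T : measurableType d) (R : realType).
Variable mu : {measure set T -> \bar R}.
Local Open Scope ereal_scope.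

(** The integral of a nonnegative function is the supremum over the simple functions below it, which
    is monotone for arbitrary functions. Network differences under any norm can thus be compared
    with their pointwise bounds. *)
Lemma le_integral_nonneg (f g : T -> \bar R) :
  (forall x, 0 <= f x) -> (forall x, f x <= g x) ->
  \int[mu]_x f x <= \int[mu]_x g x.
Proof.
move=> f0 fg; rewrite !ge0_integralTE //; last first.
  by move=> x; exact: le_trans (f0 x) (fg x).
by apply: le_ereal_sup => _ /= [h hf <-]; exists h => // x; exact: le_trans (hf x) _.
Qed.

Lemma le_Lnorm (p : \bar R) (f g : T -> \bar R) : 1 <= p ->
  (forall x, `|f x| <= `|g x|) -> Lnorm mu p f <= Lnorm mu p g.
Proof.
case: p => [p|_|//] => [|fg]; rewrite unlock /=; last first.
  by case: ifP => // _; apply: le_ess_sup; apply: nearW.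
rewrite lee_fin => p1 fg; have p0 : (0 <= p)%R by exact: le_trans p1.
apply: gt0_ler_poweR; rewrite ?invr_ge0 //.
- by rewrite in_itv /= leey andbT integral_ge0 // => x _; exact: poweR_ge0.
- by rewrite in_itv /= leey andbT integral_ge0 // => x _; exact: poweR_ge0.
apply: le_integral_nonneg => x; first exact: poweR_ge0.
by apply: gt0_ler_poweR => //; rewrite in_itv /= leey andbT.
Qed.

Lemma ge0_LnormZ (p : \bar R) (k : R) (f : T -> R) : 1 <= p -> (0 <= k)%R ->
  measurable_fun setT f ->
  Lnorm mu p (fun x => (k * f x)%:E) = k%:E * Lnorm mu p (fun x => (f x)%:E).
Proof.
case: p => [p|_|//] => [|k0 mf]; rewrite unlock /=; last first.
  (* When the whole space has measure zero, the norm at infinity is 0 by convention. *)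
  case: ifPn => mu0; last by rewrite mule0.
  rewrite -ess_supZl //; apply: eq_ess_sup; apply: nearW => x /=.
  by rewrite -EFinM normrM ger0_norm.
rewrite lee_fin => p1 k0 mf; have p0 : (0 <= p)%R by exact: le_trans p1.
have pN0 : (p != 0)%R by rewrite gt_eqF // (lt_le_trans _ p1).
have mfp : measurable_fun setT (fun x => (`|f x| `^ p)%R).
  apply: (measurableT_comp (@measurable_powR _ p)); exact: measurableT_comp.
under eq_integral do rewrite normrM powRM // (ger0_norm k0) EFinM.
rewrite ge0_integralZl //; [|exact/measurable_EFinP|by rewrite lee_fin powR_ge0].
rewrite poweRM ?lee_fin ?powR_ge0 //; last first.
  by apply: integral_ge0 => x _; rewrite lee_fin powR_ge0.
by rewrite poweR_EFin -powRrM mulfV // powRr1.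
Qed.

End LebesgueNorm.

(** * The sup norm of inputs and comparison with other norms *)

Section Supn.
Set Implicit Arguments. Unset Strict Implicit.
Variable R : realType.

Lemma measurable_supn n : measurable_fun [set: n.-tuple R] (@supn R n).
Proof.
suff H (s : seq 'I_n) : measurable_fun [set: n.-tuple R]
  (fun x : n.-tuple R => \big[Num.max/0]_(i <- s) `|tnth x i|) by exact: H.
elim: s => [|i s IH].
  by under eq_fun do rewrite big_nil; exact: measurable_cst.
under eq_fun do rewrite big_cons.
apply: measurable_maxr => //; apply: measurableT_comp => //; exact: measurable_tnth.
Qed.

Lemma supn_ge0 n (x : n.-tuple R) : 0 <= supn x.
Proof. exact: bigmax_ge_id. Qed.

Lemma norm_tnth_le_supn n (x : n.-tuple R) i : `|tnth x i| <= supn x.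
Proof. exact: (le_bigmax _ (fun i => `|tnth x i|)). Qed.

Lemma supn_le n (x : n.-tuple R) (D : R) : 0 <= D -> (supn x <= D) <-> cube D x.
Proof.
move=> D0; split=> [xD i|xD].
  by rewrite -ler_norml; exact: le_trans (norm_tnth_le_supn x i) xD.
by apply: bigmax_le => // i _; rewrite ler_norml; exact: xD.
Qed.

Lemma measurable_cube n (D : R) : 0 <= D -> measurable (@cube R n D).
Proof.
move=> D0; have -> : @cube R n D = setT `&` @supn R n @^-1` `]-oo, D].
  apply/seteqP; split=> x /=; rewrite in_itv /=.
    by move=> /(supn_le x D0).
  by case=> _ /(supn_le x D0).
exact: (measurable_supn measurableT (measurable_itv _)).
Qed.

(** For finite p this norm is [Cp] itself; at infinity [Cp] lacks the summand 1, which is restored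
    by subadditivity of the essential supremum. *)
Lemma Lnorm_supn_lty n (mu : {measure set (n.-tuple R) -> \bar R}) (p : \bar R) :
  (1 <= p)%E -> (Cp mu p < +oo)%E ->
  (Lnorm mu p (fun x => (supn x + 1)%:E) < +oo)%E.
Proof.
case: p => [p|_|//] => [|]; rewrite unlock /=.
  move=> _ C; under eq_integral do rewrite ger0_norm ?addr_ge0 ?supn_ge0 //.
  exact: C.
move=> C; case: ifP => // _.
rewrite (_ : abse \o _ = (fun x => (supn x)%:E) \+ cst 1%E)%E; last first.
  by apply/funext => x /=; rewrite ger0_norm ?addr_ge0 ?supn_ge0.
apply: le_lt_trans (ess_supD _ _ _) _.
apply: lte_add_pinfty => //.
by apply: (@le_lt_trans _ _ 1%E) (ltry _); apply/ess_supP; exact: nearW.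
Qed.

Variable q : \bar R.
Hypothesis q1 : (1 <= q)%E.

Lemma vnorm_tup2col_supn n (x : n.-tuple R) : vnorm q (tup2col x) <= n%:R * supn x.
Proof.
apply: vnorm_le_unif => //; first exact: supn_ge0.
by move=> i; rewrite mxE norm_tnth_le_supn.
Qed.

Lemma vnorm_tup2col_cube n (x : n.-tuple R) (D : R) : (0 < n)%N -> 0 <= D ->
  cube D x -> vnorm q (tup2col x) <= D * n%:R `^ einv q.
Proof.
move=> n0 D0 xD; rewrite mulrC -(ger0_norm D0) -vnorm_const // vnorm_le // => i.
by rewrite !mxE (ger0_norm D0) ler_norml; exact: xD.
Qed.

(** Follows from 0 = nm (v - v) <= 2 nm v. *)
Lemma is_norm_ge0 n (nm : 'cV[R]_n -> R) v : is_norm nm -> 0 <= nm v.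
Proof.
case=> _ hZ hD; have := hD v (- v); rewrite -scaleN1r hZ normrN1 mul1r.
by rewrite scaleN1r subrr -(scale0r v) hZ normr0 mul0r; lra.
Qed.

(** K is the sum of the norms of the basis vectors: expand v in the basis and bound each coordinate
    by the q-norm. *)
Lemma is_norm_le_vnorm n (nm : 'cV[R]_n -> R) : is_norm nm ->
  exists2 K : R, 0 <= K & forall v, nm v <= K * vnorm q v.
Proof.
move=> hn; have [h1 hZ hD] := hn.
exists (\sum_(i < n) nm (delta_mx i 0)) => [|v].
  by apply: sumr_ge0 => i _; exact: is_norm_ge0.
have nm0 : nm 0 = 0 by rewrite -(scale0r 0) hZ normr0 mul0r.
rewrite [in leLHS](matrix_sum_delta v) mulr_suml.
apply: (@le_trans _ _ (\sum_(i < n) nm (\sum_(j < 1) v i j *: delta_mx i j))).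
  elim/big_rec2: _ => [|i y1 y2 _ H]; first by rewrite nm0.
  by apply: le_trans (hD _ _) _; rewrite lerD2l.
apply: ler_sum => i _; rewrite big_ord1 hZ mulrC.
by apply: ler_wpM2l; [exact: is_norm_ge0 | exact: norm_le_vnorm].
Qed.

End Supn.

(** * Upper bounds *)

Section UpperBounds.
Set Implicit Arguments. Unset Strict Implicit.
Variable R : realType.

Lemma netdist_le (din dout : nat) (mu : {measure set (din.-tuple R) -> \bar R})
    (nm : 'cV[R]_dout -> R) (p q : \bar R) :
  is_norm nm -> (1 <= p)%E -> (1 <= q)%E -> (Cp mu p < +oo)%E ->
  exists c : R, 0 < c /\
    forall (L : nat) (N : nat -> nat) (h0 : N 0%N = din) (hL : N L = dout) (r : R),
      1 <= r -> forall th th' : params R L N, in_Theta q r th -> in_Theta q r th' ->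
      (netdist mu p nm (netfun h0 hL th) (netfun h0 hL th')
       <= (c * (width L N)%:R * L%:R ^+ 2 * r ^+ (L - 1) * pdist th th')%:E)%E.
Proof.
move=> hnm p1 q1 /(Lnorm_supn_lty p1) Clty.
have [K K0 nmK] := is_norm_le_vnorm q1 hnm.
have Cge0 := Lnorm_ge0 mu p (fun x => (supn x + 1)%:E).
have Cfin : Lnorm mu p (fun x => (supn x + 1)%:E) \is a fin_num.
  by rewrite ge0_fin_numE.
set C := fine (Lnorm mu p (fun x => (supn x + 1)%:E)).
have C0 : 0 <= C by exact: fine_ge0.
(* K compares [nm] with the q-norm, din + 1 compares |x|_q + 1 with the sup norm plus 1, and C is
   the L^p norm of the latter. The final 1 makes the constant strictly positive. *)
exists (K * (din%:R + 1) * C + 1); split.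
  by rewrite ltr_wpDl // !mulr_ge0 // addr_ge0.
move=> L N h0 hL r r1 th th' thr thr'.
set A := (width L N)%:R * L%:R ^+ 2 * r ^+ (L - 1) * pdist th th'.
have r0 : 0 <= r by exact: le_trans r1.
have A0 : 0 <= A.
  by rewrite !mulr_ge0 ?pdist_ge0 ?exprn_ge0.
have S1 (x : din.-tuple R) : 0 <= supn x + 1 by rewrite addr_ge0 ?supn_ge0.
have B0 : 0 <= K * (din%:R + 1) by rewrite mulr_ge0 // addr_ge0.
apply: (@le_trans _ _ (Lnorm mu p (fun x => (K * (din%:R + 1) * A * (supn x + 1))%:E))).
  apply: le_Lnorm => // x; rewrite !abse_EFin lee_fin ger0_norm ?is_norm_ge0 //.
  rewrite ger0_norm; last exact: mulr_ge0 (mulr_ge0 B0 A0) (S1 x).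
  have -> : K * (din%:R + 1) * A * (supn x + 1) =
      K * (A * ((din%:R + 1) * (supn x + 1))) by ring.
  apply: le_trans (nmK _) _; apply: ler_wpM2l => //.
  apply: le_trans (vnorm_netfunB _ _ _ q1 r1 thr thr') _.
  rewrite -/A; apply: ler_wpM2l => //.
  have := vnorm_tup2col_supn q1 x; have := supn_ge0 x.
  have : 0 <= din%:R :> R by exact: ler0n.
  nra.
have mS : measurable_fun setT (fun x : din.-tuple R => supn x + 1).
  by apply: measurable_funD => //; exact: measurable_supn.
rewrite ge0_LnormZ //; last exact: mulr_ge0.
rewrite -(fineK Cfin) -EFinM lee_fin -/C.
rewrite [leRHS](_ : _ = (K * (din%:R + 1) * C + 1) * A); last by rewrite /A; ring.
by rewrite mulrAC; apply: ler_wpM2r => //; rewrite lerDl.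
Qed.

Lemma lebesgue_cube (n : nat) (lam : {measure set (n.-tuple R) -> \bar R}) (D : R) :
  0 <= D -> is_lebesgue lam -> lam (cube D) = ((2 * D) ^+ n)%:E.
Proof.
move=> D0 lamE.
have := lamE [tuple - D | i < n] [tuple D | i < n].
have -> : [set x : n.-tuple R | forall i : 'I_n, tnth [tuple - D | i < n] i <=
    tnth x i <= tnth [tuple D | i < n] i] = cube D.
  apply/seteqP; split=> x /= H i; have := H i; by rewrite !tnth_mktuple.
move=> -> => [|i]; last by rewrite !tnth_mktuple; lra.
congr EFin; under eq_bigr do rewrite !tnth_mktuple.
by rewrite prodr_const card_ord opprK mulr2n mulrDl mul1r.
Qed.

(** * Explicit constants on the cube with Lebesgue measure *)

Section Cube.
Variables (d dout : nat) (D : R) (lam mu : {measure set (d.-tuple R) -> \bar R}).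
Hypothesis D0 : 0 < D.
Hypothesis lamE : is_lebesgue lam.
Hypothesis muE : forall A, measurable A -> mu A = lam (A `&` @cube R d D).

Lemma ae_cube : {ae mu, forall x, @cube R d D x}.
Proof.
exists (~` @cube R d D); split => //.
- by apply: measurableC; apply: measurable_cube; exact: ltW.
- rewrite muE ?setICl ?measure0 //.
  by apply: measurableC; apply: measurable_cube; exact: ltW.
Qed.

Lemma mu_setT_cube : mu setT = ((2 * D) ^+ d)%:E.
Proof. by rewrite muE // setTI lebesgue_cube // ltW. Qed.

(** Almost every x lies in the cube, where |x|_q is at most the q-norm of the constant vector D,
    namely D d^(1/q). *)
Lemma netdist_cube_oo (q : \bar R) : (1 <= q)%E ->
  forall (L : nat) (N : nat -> nat) (h0 : N 0%N = d) (hL : N L = dout),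
    (0 < N 0)%N -> forall r : R, 1 <= r ->
    forall th th' : params R L N, in_Theta q r th -> in_Theta q r th' ->
    (netdist mu +oo%E (@vnorm R q dout) (netfun h0 hL th) (netfun h0 hL th')
     <= ((D * d%:R `^ einv q + 1) * (width L N)%:R * L%:R ^+ 2
          * r ^+ (L - 1) * pdist th th')%:E)%E.
Proof.
move=> q1 L N h0 hL N0 r r1 th th' thr thr'.
have r0 : 0 <= r by exact: le_trans r1.
rewrite /netdist unlock; case: ifPn => _; last first.
  by rewrite lee_fin !mulr_ge0 ?pdist_ge0 ?exprn_ge0 // addr_ge0 // mulr_ge0 ?powR_ge0 // ltW.
apply/ess_supP; apply: filterS ae_cube => x xD /=.
rewrite lee_fin ger0_norm ?vnorm_ge0 //.
apply: le_trans (vnorm_netfunB _ _ _ q1 r1 thr thr') _.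
rewrite [leRHS](_ : _ = (width L N)%:R * L%:R ^+ 2 * r ^+ (L - 1) * pdist th th' *
  (D * d%:R `^ einv q + 1)); last ring.
apply: ler_wpM2l; first by rewrite !mulr_ge0 ?pdist_ge0 ?exprn_ge0.
by rewrite lerD2r; apply: vnorm_tup2col_cube => //; rewrite -?h0 // ltW.
Qed.

(** With q infinite, the pointwise factor is the sup norm plus 1, at most D + 1 on the cube; its L^p
    norm is then at most D + 1 times the p-th root of the volume (2D)^d. *)
Lemma netdist_cube_q_oo (p : \bar R) : (1 <= p)%E ->
  forall (L : nat) (N : nat -> nat) (h0 : N 0%N = d) (hL : N L = dout),
    (0 < N 0)%N -> forall r : R, 1 <= r ->
    forall th th' : params R L N, in_Theta +oo%E r th -> in_Theta +oo%E r th' ->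
    (netdist mu p (@vnorm R +oo%E dout) (netfun h0 hL th) (netfun h0 hL th')
     <= ((D + 1) * (2 * D) `^ (d%:R * einv p) * (width L N)%:R * L%:R ^+ 2
          * r ^+ (L - 1) * pdist th th')%:E)%E.
Proof.
move=> p1 L N h0 hL N0 r r1 th th' thr thr'.
have r0 : 0 <= r by exact: le_trans r1.
have q1 : (1 <= +oo :> \bar R)%E by exact: leey.
case: p p1 => [p| |//]; last first.
  (* At p infinite [einv] is 0, so the volume factor is 1 and the preceding bound applies. *)
  move=> _; rewrite /= mulr0 powRr0 mulr1.
  by have /= := netdist_cube_oo q1 h0 hL N0 r1 thr thr'; rewrite powRr0 mulr1; apply.
rewrite lee_fin => p1; have p0 : 0 <= p by exact: le_trans p1.
have pN0 : p != 0 by rewrite gt_eqF // (lt_le_trans _ p1).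
set A := (width L N)%:R * L%:R ^+ 2 * r ^+ (L - 1) * pdist th th'.
have A0 : 0 <= A.
  by rewrite !mulr_ge0 ?pdist_ge0 ?exprn_ge0.
have S1 (x : d.-tuple R) : 0 <= supn x + 1 by rewrite addr_ge0 ?supn_ge0.
apply: (@le_trans _ _ (Lnorm mu p%:E (fun x => (A * (supn x + 1))%:E))).
  apply: le_Lnorm => // x; rewrite !abse_EFin lee_fin ger0_norm ?vnorm_ge0 //.
  rewrite ger0_norm; last exact: mulr_ge0.
  apply: le_trans (vnorm_netfunB _ _ _ q1 r1 thr thr') _.
  rewrite -/A; apply: ler_wpM2l => //; rewrite lerD2r /=.
  by apply: bigmax_le => [|i _]; rewrite ?supn_ge0 // mxE norm_tnth_le_supn.
have mS : measurable_fun setT (fun x : d.-tuple R => supn x + 1).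
  by apply: measurable_funD => //; exact: measurable_supn.
rewrite ge0_LnormZ // (_ : (_ * pdist th th')%:E = (A * ((D + 1) * (2 * D) `^ (d%:R * p^-1)))%:E);
  last by congr EFin; rewrite /A /=; ring.
rewrite [leRHS]EFinM; apply: lee_wpmul2l; first by rewrite lee_fin.
have D1 : 0 <= D + 1 by rewrite addr_ge0 // ltW.
have intle : (\int[mu]_x (`|(supn x + 1)%:E| `^ p) <=
    (((D + 1) * (2 * D) `^ (d%:R * p^-1)) `^ p)%:E)%E.
  apply: (@le_trans _ _ (\int[mu]_x (cst ((D + 1) `^ p)%:E) x)%E).
    apply: ae_ge0_le_integral => //.
    - by move=> x _; exact: poweR_ge0.
    - apply/measurable_EFinP => /=; apply: (measurableT_comp (@measurable_powR _ p)).
      exact: measurableT_comp.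
    - by move=> x _; rewrite lee_fin powR_ge0.
    - apply: filterS ae_cube => x xD _ /=; rewrite lee_fin ger0_norm //.
      rewrite ge0_ler_powR ?nnegrE // lerD2r; exact/supn_le/xD/ltW.
  rewrite integral_cst // mu_setT_cube -EFinM lee_fin powRM ?powR_ge0 //.
  by rewrite -powRrM -mulrA mulVf // mulr1 powR_mulrn // mulr_ge0 // ltW.
rewrite unlock; apply: (@le_trans _ _ ((((D + 1) * (2 * D) `^ (d%:R * p^-1)) `^ p)%:E `^ p^-1)%E).
  apply: gt0_ler_poweR; rewrite ?invr_ge0 ?in_itv /= ?leey ?andbT ?lee_fin ?powR_ge0 //.
  by apply: integral_ge0 => x _; rewrite lee_fin powR_ge0.
by rewrite poweR_EFin -powRrM mulfV // powRr1 // mulr_ge0 ?powR_ge0.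
Qed.

End Cube.
End UpperBounds.

(** * Lower bound *)

Section LowerBound.
Set Implicit Arguments. Unset Strict Implicit.
Variable R : realType.

Lemma bernoulli_le (s : R) n : 0 <= s <= 1 -> 1 - n%:R * s <= (1 - s) ^+ n.
Proof.
move=> /andP[s0 s1]; elim: n => [|n IH]; first by rewrite expr0 mul0r subr0.
have n0 : 0 <= n%:R :> R by exact: ler0n.
apply: (@le_trans _ _ ((1 - s) * (1 - n%:R * s))); first by rewrite -natr1; nra.
by rewrite exprS; apply: ler_wpM2l => //; lra.
Qed.

(** The right side is s times the geometric sum of the (1 - s)^k for k <= n, and each of these terms
    is at least (1 - s)^n. *)
Lemma onem_exp_ge (s : R) n : 0 <= s <= 1 ->
  n.+1%:R * s * (1 - s) ^+ n <= 1 - (1 - s) ^+ n.+1.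
Proof.
move=> /andP[s0 s1]; elim: n => [|n IH]; first by rewrite expr1 expr0; lra.
have v0 : 0 <= (1 - s) ^+ n by rewrite exprn_ge0 //; lra.
have n0 : 0 <= n.+1%:R :> R by exact: ler0n.
have H : n.+1%:R * s * (1 - s) ^+ n.+1 <= n.+1%:R * s * (1 - s) ^+ n.
  by apply: ler_wpM2l; [exact: mulr_ge0 | rewrite exprS ler_piMl //; lra].
rewrite [(1 - s) ^+ n.+2]exprS -natr1; nra.
Qed.

Lemma vnorm_single (q : \bar R) n (v : 'cV[R]_n) i0 : (1 <= q)%E ->
  (forall i, i != i0 -> v i 0 = 0) -> vnorm q v = `|v i0 0|.
Proof.
move=> q1 v0; apply/le_anti/andP; split; last exact: norm_le_vnorm.
case: q q1 => [p| |//] /=.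
  rewrite lee_fin => p1; have pN0 : p != 0 by rewrite gt_eqF // (lt_le_trans _ p1).
  rewrite (bigD1 i0) //= big1 ?addr0; last by move=> i /v0 ->; rewrite normr0 powR0.
  by rewrite -powRrM mulfV // powRr1.
move=> _; apply: bigmax_le => // i _.
by have [->|/v0 ->] := eqVneq i i0; rewrite ?normr0.
Qed.

(** * Networks supported on the corner entry of each weight matrix *)

Variables (L : nat) (N : nat -> nat).

(** The entry is recognised by the numeric values of its indices, so one formula covers all layer
    dimensions. *)
Definition corner (a : R) : params R L N :=
  ([ffun w : widx L N => let: existT _ (i, j) := w in
      if (val i == 0%N) && (val j == 0%N) then a else 0], [ffun=> 0]).

Lemma Wmat_corner a l i j :
  Wmat (corner a) l i j = if (val i == 0%N) && (val j == 0%N) then a else 0.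
Proof. by rewrite mxE ffunE. Qed.

Lemma bvec_corner a l : bvec (corner a) l = 0.
Proof. by apply/colP => i; rewrite !mxE ffunE. Qed.

Lemma mulmx_corner a (l : 'I_L) (v : 'cV[R]_(N l)) i (j0 : 'I_(N l)) : val j0 = 0%N ->
  (Wmat (corner a) l *m v) i 0 = if val i == 0%N then a * v j0 0 else 0.
Proof.
move=> j00; rewrite mxE (bigD1 j0) //= big1 ?addr0 => [|j jj0].
  by rewrite Wmat_corner /= j00 eqxx andbT; case: ifP => //; rewrite mul0r.
rewrite Wmat_corner; case: ifP; rewrite ?mul0r // => /andP[_ /eqP jE].
by move: jj0; rewrite -val_eqE /= j00 jE.
Qed.

(** The image of x has at most one nonzero coordinate, a x_1, so its q-norm is at most a |x|_q. *)
Lemma corner_in_Theta (q : \bar R) (r a : R) : (1 <= q)%E ->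
  (forall l, (l <= L)%N -> (0 < N l)%N) -> 0 <= a <= r -> in_Theta q r (corner a).
Proof.
move=> q1 Npos /andP[a0 ar] l; rewrite bvec_corner vnorm0 //.
split; last exact: le_trans ar.
have Nl := Npos l (ltnW (ltn_ord l)); apply: opnorm_le => // x.
have Nl1 := Npos l.+1 (ltn_ord l).
rewrite (@vnorm_single q _ _ (Ordinal Nl1)) // => [|i].
  rewrite (mulmx_corner _ _ _ (j0 := Ordinal Nl)) //= normrM (ger0_norm a0).
  by apply: ler_pM => //; exact: norm_le_vnorm.
by rewrite (mulmx_corner _ _ _ (j0 := Ordinal Nl)) // -val_eqE /= => /negbTE ->.
Qed.

Lemma pdist_corner a b : pdist (corner a) (corner b) <= `|a - b|.
Proof.
rewrite /pdist ge_max; apply/andP; split; apply: bigmax_le => // i _.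
  by rewrite !ffunE; case: i => l [i j]; case: ifP => //; rewrite subrr normr0.
by rewrite !ffunE subrr normr0.
Qed.

(** For L = 1 the only layer is affine and x_1 passes unchanged. Otherwise the first ReLU yields the
    positive part of x_1, and later ones act trivially on nonnegative values. *)
Lemma fwd_corner a k x (i : 'I_(N k)) (i0 : 'I_(N 0)) : 0 <= a ->
  (forall l, (l <= L)%N -> (0 < N l)%N) -> val i0 = 0%N -> (0 < k <= L)%N ->
  fwd (corner a) k x i 0 = if val i == 0%N
    then a ^+ k * (if L == 1%N then x i0 0 else Num.max (x i0 0) 0) else 0.
Proof.
move=> a0 Npos i00; set m := (if L == 1%N then _ else _).
case: k i => // k i /= kL.
elim: k kL i => [|k IH] kL i.
  rewrite (stepE _ kL) /preact bvec_corner addr0 expr1 /m [L == _]eq_sym.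
  case: ifP => L1; first exact: mulmx_corner.
  rewrite mxE (@mulmx_corner a (Ordinal kL) x i i0 i00); case: ifP; rewrite ?maxxx //.
  by rewrite maxr_pMr // mulr0.
rewrite fwdS (stepE _ kL) /preact bvec_corner addr0.
have Nk := Npos k.+1 (ltnW kL).
have E : (Wmat (corner a) (Ordinal kL) *m fwd (corner a) k.+1 x) i 0 =
    if val i == 0%N then a ^+ k.+2 * m else 0.
  rewrite (@mulmx_corner a (Ordinal kL) _ i (Ordinal Nk) erefl).
  by rewrite IH ?(ltnW kL) //= mulrA -exprS.
case: ifP => // kNL; rewrite mxE E; case: ifP; rewrite ?maxxx // => _.
apply/max_idPl; rewrite mulr_ge0 ?exprn_ge0 // /m.
case: eqP => [L1|_]; last by rewrite le_max lexx orbT.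
by exfalso; move: (kL); rewrite L1.
Qed.

Lemma netfun_corner din dout (h0 : N 0%N = din) (hL : N L = dout) a x
    (i0 : 'I_din) (j0 : 'I_dout) : (0 < L)%N -> 0 <= a ->
  (forall l, (l <= L)%N -> (0 < N l)%N) -> val i0 = 0%N -> val j0 = 0%N ->
  netfun h0 hL (corner a) x j0 0 =
    a ^+ L * (if L == 1%N then tnth x i0 else Num.max (tnth x i0) 0).
Proof.
move=> L0 a0 Npos i00 j00; subst din dout.
rewrite /netfun !castmx_id /realization (fwd_corner _ _ a0 Npos i00) ?L0 ?leqnn //.
by rewrite j00 eqxx mxE.
Qed.

End LowerBound.

(** * The lower bound and its constant *)

Section LowerBoundTheorem.
Set Implicit Arguments. Unset Strict Implicit.
Variable R : realType.

Lemma netdist_ge (din dout : nat) (Om : set (din.-tuple R))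
    (mu : {measure set (din.-tuple R) -> \bar R}) (p q : \bar R) (i0 : 'I_din) :
  measurable Om -> (1 <= p)%E -> (1 <= q)%E -> (Cp mu p < +oo)%E ->
  (forall x, Om x -> 0 <= tnth x i0) -> val i0 = 0%N ->
  (0 < mu (Om `&` [set x : din.-tuple R | tnth x i0 != 0%R]))%E ->
  exists c' : R, 0 < c' /\
    forall (L : nat) (N : nat -> nat) (h0 : N 0%N = din) (hL : N L = dout),
      (0 < L)%N -> (forall l, (l <= L)%N -> (0 < N l)%N) ->
      forall r : R, 1 <= r -> forall eps : R, 0 < eps ->
      exists th th' : params R L N,
        [/\ in_Theta q r th, in_Theta q r th', th <> th' &
          (((1 - eps) * c' * L%:R * r ^+ (L - 1) * pdist th th')%:E
           <= netdist mu p (@vnorm R q dout) (netfun h0 hL th) (netfun h0 hL th'))%E].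
Proof.
move=> mOm p1 q1 Clty Om0 i00 muOm.
(* On [Om] this is x_1. Taking the positive part keeps it nonnegative elsewhere, and it is at most
   |x_1|, so it also serves when L = 1. *)
pose f (x : din.-tuple R) := Num.max (tnth x i0) 0.
have f0 x : 0 <= f x by rewrite le_max lexx orbT.
have mf : measurable_fun setT f.
  by apply: measurable_maxr => //; exact: measurable_tnth.
have Cge0 := Lnorm_ge0 mu p (fun x => (f x)%:E).
have Clt : (Lnorm mu p (fun x => (f x)%:E) < +oo)%E.
  apply: le_lt_trans (Lnorm_supn_lty p1 Clty); apply: le_Lnorm => // x.
  rewrite !abse_EFin lee_fin (ger0_norm (f0 x)) ger0_norm ?addr_ge0 ?supn_ge0 //.
  rewrite ge_max addr_ge0 ?supn_ge0 // andbT.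
  have := norm_tnth_le_supn x i0; have := ler_norm (tnth x i0); lra.
have Cfin : Lnorm mu p (fun x => (f x)%:E) \is a fin_num by rewrite ge0_fin_numE.
(* A zero norm would make f vanish almost everywhere, whereas f is nonzero on a subset of [Om] of
   positive measure. *)
have Cneq0 : (Lnorm mu p (fun x => (f x)%:E) != 0)%E.
  apply/eqP => /Lnorm_eq0_eq0 H.
  have [||A [mA muA0 sA]] := H; [exact/measurable_EFinP | exact: lt_le_trans p1 |].
  move: muOm; rewrite (@subset_measure0 _ _ _ mu _ A) ?ltxx //.
    apply: measurableI => //.
    have -> : [set x : din.-tuple R | tnth x i0 != 0] =
        setT `&` (fun x => tnth x i0) @^-1` (~` [set 0]).
      by apply/seteqP; split=> x /= => [/eqP|[_ /eqP]].
    by apply: measurable_tnth => //; apply: measurableC; exact: measurable_set1.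
  move=> x [Omx /= x0]; apply: sA => /= /(_ I) [] /eqP.
  by rewrite /f max_l ?Om0 // (negbTE x0).
set C := fine (Lnorm mu p (fun x => (f x)%:E)).
have C0 : 0 < C by rewrite fine_gt0 // Clt lt_neqAle eq_sym Cneq0 Cge0.
exists C; split => // L N h0 hL L0 Npos r r1 eps eps0.
have r0 : 0 < r by exact: lt_le_trans r1.
have LR0 : 0 < L%:R :> R by rewrite ltr0n.
(* Chosen so that s <= 1 and L s = min(eps, 1); Bernoulli's inequality then keeps (1 - s)^(L-1)
   above 1 - eps when eps < 1. *)
pose s := Num.min eps 1 / L%:R.
have e0 : 0 < Num.min eps 1 by rewrite lt_min eps0 /=.
have s0 : 0 < s by rewrite divr_gt0.
have LsE : L%:R * s = Num.min eps 1 by rewrite mulrCA mulfV ?gt_eqF // mulr1.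
have s1 : s <= 1.
  rewrite ler_pdivrMr // mul1r; apply: (@le_trans _ _ 1); first by rewrite ge_min lexx orbT.
  by rewrite ler1n.
have b0 : 0 <= r * (1 - s) <= r.
  by rewrite mulr_ge0 ?subr_ge0 ?(ltW r0) //= ler_piMr ?(ltW r0) // gerBl ltW.
exists (corner L N r), (corner L N (r * (1 - s))); split.
- by apply: corner_in_Theta => //; rewrite lexx (ltW r0).
- exact: corner_in_Theta.
(* The corner entries of the first layer differ by r s, which is positive. *)
- move=> thE; have N1 := Npos 1%N L0; have N0 := Npos 0%N isT.
  have := @Wmat_corner R L N (r * (1 - s)) (Ordinal L0) (Ordinal N1) (Ordinal N0).
  rewrite -thE Wmat_corner /= => rE; have : r * s = 0 by lra.
  by apply/eqP; rewrite mulf_neq0 ?gt_eqF.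
set K := r ^+ L - (r * (1 - s)) ^+ L.
have KE : K = r ^+ L * (1 - (1 - s) ^+ L) by rewrite /K exprMn; ring.
have K0 : 0 <= K.
  rewrite KE mulr_ge0 ?exprn_ge0 ?(ltW r0) // subr_ge0 exprn_ile1 ?subr_ge0 // gerBl ltW //.
have dout0 : (0 < dout)%N by rewrite -hL Npos.
(* The q-norm of the output difference is bounded below by its first coordinate, which is at least K
   f(x) in absolute value. *)
apply: (@le_trans _ _ (Lnorm mu p (fun x => (K * f x)%:E))); last first.
  apply: le_Lnorm => // x; rewrite !abse_EFin lee_fin !ger0_norm ?vnorm_ge0 ?mulr_ge0 //.
  apply: le_trans _ (norm_le_vnorm q1 _ (Ordinal dout0)).
  have [b0' _] := andP b0.
  rewrite 2!mxE !(netfun_corner h0 hL x (i0 := i0)) // ?(ltW r0) // -mulrBl -/K.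
  rewrite normrM (ger0_norm K0); apply: ler_wpM2l => //.
  case: ifP => _; last by rewrite ler_norm.
  by rewrite ge_max normr_ge0 ler_norm.
rewrite ge0_LnormZ // -(fineK Cfin) -EFinM lee_fin -/C.
rewrite [leLHS](_ : _ = (1 - eps) * L%:R * r ^+ (L - 1) *
  pdist (corner L N r) (corner L N (r * (1 - s))) * C); last ring.
apply: ler_wpM2r; first exact: ltW.
(* For eps >= 1 the left side is nonpositive while K is nonnegative. *)
have [e1|e1] := leP 1 eps.
  apply: le_trans K0; rewrite -!mulrA; apply: mulr_le0_ge0; first lra.
  by rewrite !mulr_ge0 ?pdist_ge0 ?exprn_ge0 // ltW.
have pd : pdist (corner L N r) (corner L N (r * (1 - s))) <= r * s.
  apply: le_trans (pdist_corner _ _ _ _) _.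
  by rewrite (_ : r - _ = r * s); [rewrite ger0_norm // mulr_ge0 // ltW | ring].
apply: (@le_trans _ _ ((1 - eps) * L%:R * r ^+ (L - 1) * (r * s))).
  by apply: ler_wpM2l => //; rewrite !mulr_ge0 ?exprn_ge0 ?(ltW r0) //; lra.
rewrite KE; case: (L) L0 LsE => // n _ LsE.
rewrite subn1 /= (_ : _ * (r * s) = r ^+ n.+1 * ((1 - eps) * (n.+1%:R * s))); last first.
  by rewrite exprS; ring.
apply: ler_wpM2l; first by rewrite exprn_ge0 // ltW.
have s01 : 0 <= s <= 1 by rewrite (ltW s0).
apply: le_trans _ (onem_exp_ge n s01); rewrite mulrC.
(* It remains that 1 - eps <= (1 - s)^(L-1), which Bernoulli reduces to (L - 1) s <= eps. *)
apply: ler_wpM2l; first by rewrite mulr_ge0 // ltW.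
apply: le_trans _ (bernoulli_le n s01).
have : n%:R * s <= eps; last lra.
move: LsE; rewrite -natr1 mulrDl mul1r (min_idPl (ltW e1)); lra.
Qed.

End LowerBoundTheorem.

(** * Assembly of the upper and lower bounds *)

Theorem mainTheorem2 (R : realType) :
  (* (i) general upper bound *)
  (forall (din dout : nat) (Om : set (din.-tuple R))
      (mu : {measure set (din.-tuple R) -> \bar R})
      (nm : 'cV[R]_dout -> R) (p q : \bar R),
    measurable Om -> mu (~` Om) = 0%E ->
    is_norm nm -> (1 <= p)%E -> (1 <= q)%E -> (Cp mu p < +oo)%E ->
    exists c : R, 0 < c /\
      forall (L : nat) (N : nat -> nat) (h0 : N 0%N = din) (hL : N L = dout),
        (0 < L)%N -> (forall l, (l <= L)%N -> (0 < N l)%N) ->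
        forall r : R, 1 <= r ->
        forall th th' : params R L N,
          in_Theta q r th -> in_Theta q r th' ->
          (netdist mu p nm (netfun h0 hL th) (netfun h0 hL th')
           <= (c * (width L N)%:R * L%:R ^+ 2 * r ^+ (L - 1) * pdist th th')%:E)%E)
  /\
  (* (i), explicit constant: Omega = [-D,D]^d, Lebesgue, p = oo, norm = ||.||_q *)
  (forall (d dout : nat) (D : R) (lam mu : {measure set (d.-tuple R) -> \bar R})
      (q : \bar R),
    0 < D -> is_lebesgue lam ->
    (forall A, measurable A -> mu A = lam (A `&` @cube R d D)) ->
    (1 <= q)%E ->
    forall (L : nat) (N : nat -> nat) (h0 : N 0%N = d) (hL : N L = dout),
      (0 < L)%N -> (forall l, (l <= L)%N -> (0 < N l)%N) ->
      forall r : R, 1 <= r ->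
      forall th th' : params R L N,
        in_Theta q r th -> in_Theta q r th' ->
        (netdist mu +oo%E (@vnorm R q dout) (netfun h0 hL th) (netfun h0 hL th')
         <= ((D * d%:R `^ einv q + 1) * (width L N)%:R * L%:R ^+ 2
              * r ^+ (L - 1) * pdist th th')%:E)%E)
  /\
  (* (i), explicit constant: Omega = [-D,D]^d, Lebesgue, norm = ||.||_oo, q = oo *)
  (forall (d dout : nat) (D : R) (lam mu : {measure set (d.-tuple R) -> \bar R})
      (p : \bar R),
    0 < D -> is_lebesgue lam ->
    (forall A, measurable A -> mu A = lam (A `&` @cube R d D)) ->
    (1 <= p)%E ->
    forall (L : nat) (N : nat -> nat) (h0 : N 0%N = d) (hL : N L = dout),
      (0 < L)%N -> (forall l, (l <= L)%N -> (0 < N l)%N) ->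
      forall r : R, 1 <= r ->
      forall th th' : params R L N,
        in_Theta +oo%E r th -> in_Theta +oo%E r th' ->
        (netdist mu p (@vnorm R +oo%E dout) (netfun h0 hL th) (netfun h0 hL th')
         <= ((D + 1) * (2 * D) `^ (d%:R * einv p) * (width L N)%:R * L%:R ^+ 2
              * r ^+ (L - 1) * pdist th th')%:E)%E)
  /\
  (* (ii) lower bound *)
  (forall (din dout : nat) (Om : set (din.-tuple R))
      (mu : {measure set (din.-tuple R) -> \bar R}) (p q : \bar R),
    measurable Om -> mu (~` Om) = 0%E ->
    (1 <= p)%E -> (1 <= q)%E -> (Cp mu p < +oo)%E ->
    (forall x, Om x -> forall i : 'I_din, 0 <= tnth x i) ->
    (0 < mu (Om `&` [set x : din.-tuple R | exists i : 'I_din, val i = 0%N /\ tnth x i != 0%R]))%E ->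
    exists c' : R, 0 < c' /\
      forall (L : nat) (N : nat -> nat) (h0 : N 0%N = din) (hL : N L = dout),
        (0 < L)%N -> (forall l, (l <= L)%N -> (0 < N l)%N) ->
        (p = +oo%E \/ forall l, (l <= L)%N -> (N 0%N <= N l)%N) ->
        forall r : R, 1 <= r -> forall eps : R, 0 < eps ->
        exists th th' : params R L N,
          [/\ in_Theta q r th, in_Theta q r th', th <> th' &
            (((1 - eps) * c' * L%:R * r ^+ (L - 1) * pdist th th')%:E
             <= netdist mu p (@vnorm R q dout) (netfun h0 hL th) (netfun h0 hL th'))%E]).
Proof.
split; [|split; [|split]].
- move=> din dout Om mu nm p q _ _ hnm p1 q1 /(netdist_le hnm p1 q1) [c [c0 H]].
  by exists c; split=> // L N h0 hL _ _; exact: H.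
- move=> d dout D lam mu q D0 lamE muE q1 L N h0 hL _ Npos r r1 th th' thr thr'.
  by apply: (netdist_cube_oo D0 muE) => //; exact: Npos.
- move=> d dout D lam mu p D0 lamE muE p1 L N h0 hL _ Npos r r1 th th' thr thr'.
  by apply: (netdist_cube_q_oo D0 lamE muE) => //; exact: Npos.
- move=> din dout Om mu p q mOm _ p1 q1 Clty Om0 muOm.
  case: din => [|n] in Om mu mOm Clty Om0 muOm *.
    (* In dimension zero there is no first coordinate, so the set of positive measure would be
       empty. *)
    move: muOm; rewrite (_ : _ `&` _ = set0) ?measure0 ?ltxx //.
    by apply/seteqP; split => // x [_ [[]]].
  have : (0 < mu (Om `&` [set x : n.+1.-tuple R | tnth x ord0 != 0%R]))%E.
    rewrite (_ : [set x | _] = [set x : n.+1.-tuple R | exists i, val i = 0%N /\ tnth x i != 0]) //.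
    apply/seteqP; split=> x /=; first by exists ord0.
    by case=> i [i0 xi]; rewrite (_ : ord0 = i) //; exact: val_inj.
  move=> /(netdist_ge dout mOm p1 q1 Clty (fun x Omx => Om0 x Omx ord0) erefl) [c [c0 H]].
  by exists c; split=> // L N h0 hL L0 Npos _; exact: H.
Qed.
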